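(* Let $U,V$ be real separable Hilbert spaces, let $\alpha\in(0,\tfrac12)$, let $B=(B_t,t\in\mathbb{R})$ be a $U$-cylindrical $\alpha$-regular Volterra process, let $A$ be the infinitesimal generator of a strongly continuous semigroup $(S(t),t\ge 0)$ of bounded linear operators on $V$, and let $\varPhi\in\mathcal{L}(U,V)$. Assume that $B$ has stationary and reflexive increments, that $S(u)\varPhi\in\mathcal{L}_2(U,V)$ for every $u>0$, and that $$\int_0^\infty \|S(r)\varPhi\|_{\mathcal{L}_2(U,V)}^{\frac{2}{1+2\alpha}}\,\mathrm{d}r<\infty .$$ For $x\in L^2(\Omega;V)$ let $X^x_t=S(t)x+\int_0^tS(t-r)\varPhi\,\mathrm{d}B_r$, $t\ge0$, be the mild solution of $\mathrm{d}X_t=AX_t\,\mathrm{d}t+\varPhi\,\mathrm{d}B_t$, $X_0=x$, and let $\mu_t^x$ be the probability law of $X^x_t$ on $V$. Let $\mu_\infty$ be the weak limit of $\mu_t^0$ as $t\to\infty$ (which exists under these assumptions). Let $x\in L^2(\Omega;V)$ be such that $\lim_{t\to\infty}|S(t)x|_V=0$ almost surely. Then $\mu_t^x\to\mu_\infty$ weakly as $t\to\infty$. In particular, if the semigroup $(S(t),t\ge0)$ is strongly stable (i.e. $S(t)\to0$ as $t\to\infty$ in the strong operator topology), then $\mu^x_t\to\mu_\infty$ weakly as $t\to\infty$ for every $x\in L^2(\Omega;V)$.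
   Context: **Kernels.** For $\alpha\in(0,\frac12)$, an $\alpha$-regular Volterra kernel is a (Borel measurable) function $K:\mathbb{R}^2\to\mathbb{R}$ such that: $K(t,r)=0$ whenever $t<r$ and $\lim_{t\to r+}K(t,r)=0$ for every $r\in\mathbb{R}$; $K(\cdot,r)$ is continuously differentiable on $(r,\infty)$ for every $r$; there is a finite constant $C>0$ with $\left|\frac{\partial K}{\partial u}(u,r)\right|\le C(u-r)^{\alpha-1}$ for all $r<u$ (here $\frac{\partial K}{\partial u}$ is the derivative in the first variable). Put $$R(s_1,t_1,s_2,t_2):=\int_{\mathbb{R}}(K(t_1,r)-K(s_1,r))(K(t_2,r)-K(s_2,r))\,\mathrm{d}r .$$ **Scalar processes and integral.** A real process $b=(b_t,t\in\mathbb{R})$ is an $\alpha$-regular Volterra process (with kernel $K$) if it is centred, $b_0=0$, and $\mathbb{E}(b_{t_1}-b_{s_1})(b_{t_2}-b_{s_2})=R(s_1,t_1,s_2,t_2)$ for all $s_1,t_1,s_2,t_2\in\mathbb{R}$; its continuous version is always used. Let $\mathcal{E}(\mathbb{R};V)$ be the $V$-valued step functions $f=\sum_{j=1}^nf_j\mathbf{1}_{[t_{j-1},t_j)}$ ($f_j\in V$, $-\infty<t_0<\dots<t_n<\infty$), $i(f):=\sum_jf_j(b_{t_j}-b_{t_{j-1}})$ and $(\mathcal{K}^*f)(r):=\int_r^\infty f(u)\frac{\partial K}{\partial u}(u,r)\,\mathrm{d}u$. Then $\|i(f)\|_{L^2(\Omega;V)}=\|\mathcal{K}^*f\|_{L^2(\mathbb{R};V)}$.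 $\mathcal{D}(\mathbb{R};V)$ is the completion of $\mathcal{E}(\mathbb{R};V)$ under $\langle f,g\rangle_{\mathcal{D}}:=\langle\mathcal{K}^*f,\mathcal{K}^*g\rangle_{L^2(\mathbb{R};V)}$ ($\mathcal{K}^*$ is assumed injective, otherwise one passes to the quotient by $\ker\mathcal{K}^*$), and $i$ is extended to an isometry $\mathcal{D}(\mathbb{R};V)\to L^2(\Omega;V)$, written $\int f\,\mathrm{d}b:=i(f)$. Functions in $L^{\frac{2}{1+2\alpha}}(\mathbb{R};V)$ are viewed as elements of $\mathcal{D}(\mathbb{R};V)$ via the continuous extension of $\mathcal{E}(\mathbb{R};V)\to\mathcal{D}(\mathbb{R};V)$. **Cylindrical processes and integral.** A $U$-cylindrical $\alpha$-regular Volterra process is a collection $B=(B_t,t\in\mathbb{R})$ of bounded linear operators $B_t:U\to L^2(\Omega)$ such that for every $u\in U$, $B(u)=(B_t(u))_t$ is a centred real process with $B_0(u)=0$, and, for some $\alpha$-regular Volterra kernel $K$ with associated $R$, $\mathbb{E}(B_{t_1}(u_1)-B_{s_1}(u_1))(B_{t_2}(u_2)-B_{s_2}(u_2))=R(s_1,t_1,s_2,t_2)\langle u_1,u_2\rangle_U$ for all times and all $u_1,u_2\in U$. $\mathcal{L}_2$ denotes Hilbert–Schmidt operators. For a complete orthonormal basis $\{e_k\}$ of $U$ and an elementary operator $Gu=\sum_{k=1}^{N}g_k\langle u,e_k\rangle_U$ with $g_k\in\mathcal{D}(\mathbb{R};V)$, set $I(G):=\sum_{k=1}^{N}\int g_k\,\mathrm{d}b^{(k)}$,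 $b^{(k)}=B(e_k)$; $I$ extends to a linear isometry $\mathcal{L}_2(U,\mathcal{D}(\mathbb{R};V))\to L^2(\Omega;V)$. A function $G:\mathbb{R}\to\mathcal{L}_2(U,V)$ is identified with the operator $u\mapsto G(\cdot)u$, and $\int_s^tG(r)\,\mathrm{d}B_r:=I(\mathbf{1}_{[s,t)}G)$, which is defined whenever $G\in L^{\frac{2}{1+2\alpha}}(s,t;\mathcal{L}_2(U,V))$. **Increments.** An $\mathbb{R}^d$-valued process $Y=(Y_t,t\in\mathbb{R})$ has stationary increments if for all $n$, all $s_i<t_i$ ($i=1,\dots,n$) and all $h\in\mathbb{R}$ the vectors $(Y_{t_i}-Y_{s_i})_{i=1}^n$ and $(Y_{t_i+h}-Y_{s_i+h})_{i=1}^n$ have the same law; it has reflexive increments if for all $n$ and all $s_i<t_i$ the vectors $(Y_{t_i}-Y_{s_i})_{i=1}^n$ and $(Y_{-s_i}-Y_{-t_i})_{i=1}^n$ have the same law. $B$ has stationary (reflexive) increments if for every $n$ and $u_1,\dots,u_n\in U$ the $\mathbb{R}^n$-valued process $(B(u_1),\dots,B(u_n))$ does. *)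

(* Defs.v *)
From HB Require Import structures.
From mathcomp Require Import all_boot all_order all_algebra.
From mathcomp Require Import all_classical all_reals all_analysis.

Set Implicit Arguments.
Unset Strict Implicit.
Unset Printing Implicit Defensive.
Import Order.TTheory GRing.Theory Num.Theory.
Import numFieldNormedType.Exports.

Local Open Scope classical_set_scope.
Local Open Scope ring_scope.

HB.mixin Record NormedModule_hasInner (R : realType) V of NormedModule R V := {
  inner : V -> V -> R;
  innerC : forall u v, inner u v = inner v u;
  innerP : forall a u v w, inner (a *: u + v) w = a * inner u w + inner v w;
  inner_norm : forall v, inner v v = `|v| ^+ 2 }.

#[short(type="hilbertType")]
HB.structure Definition Hilbert (R : realType) :=
  { V of CompleteNormedModule R V & NormedModule_hasInner R V }.

Definition separable (T : topologicalType) :=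
  exists2 D : set T, countable D & dense D.

(* A countable complete orthonormal basis, indexed by a subset of nat so that
   finite-dimensional spaces are covered. *)
Record onbasis (R : realType) (U : hilbertType R) := OnBasis {
  onb_dom : pred nat;
  onb_vec :> nat -> U;
  onb_orthonormal : {in onb_dom &, forall i j,
    inner (onb_vec i) (onb_vec j) = (i == j)%:R};
  onb_complete : forall u : U,
    \sum_(i < n | onb_dom i) inner u (onb_vec i) *: onb_vec i @[n --> \oo]
      --> u }.

Section operators.
Context {R : realType} {U V : hilbertType R}.

Definition hs_norm (e : onbasis U) (T : U -> V) : \bar R :=
  ((\sum_(k <oo | onb_dom e k) (`|T (e k)| ^+ 2)%:E) `^ 2^-1)%E.

Definition hilbert_schmidt (e : onbasis U) (T : {linear U -> V}) :=
  continuous T /\ (hs_norm e T < +oo)%E.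

End operators.

Section semigroups.
Context {R : realType} {V : hilbertType R}.

(* [S t] is irrelevant for [t < 0]. *)
Definition c0_semigroup (S : R -> {linear V -> V}) :=
  [/\ forall t, 0 <= t -> continuous (S t),
      forall v, S 0 v = v,
      forall s t, 0 <= s -> 0 <= t -> forall v, S (s + t) v = S s (S t v)
    & forall v, S t v @[t --> 0^'+] --> v].

(* [A] is meaningful on its domain [DA] only. *)
Definition is_generator (S : R -> {linear V -> V}) (DA : set V) (A : V -> V) :=
  DA = [set v | cvg (h^-1 *: (S h v - v) @[h --> 0^'+])] /\
  forall v, DA v -> h^-1 *: (S h v - v) @[h --> 0^'+] --> A v.

Definition strongly_stable (S : R -> {linear V -> V}) :=
  forall v, S t v @[t --> +oo] --> (0 : V).

End semigroups.

Section random_vectors.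
Context {R : realType}.

Definition borel (V : hilbertType R) := g_sigma_algebraType (@open V).

Context {d : measure_display} {T : measurableType d}.
Variable mu : {measure set T -> \bar R}.

Definition bLnorm (V : hilbertType R) (p : R) (f : T -> V) : \bar R :=
  'N[mu]_p%:E[(fun x => `|f x|%:E)].

(* For separable [V], Borel and strong measurability coincide. *)
Definition bLfun (V : hilbertType R) (p : R) (f : T -> V) :=
  measurable_fun setT (f : T -> borel V) /\ (bLnorm p f < +oo)%E.

End random_vectors.

Definition weak_cvg {R : realType} {V : hilbertType R}
    (mu : R -> set (borel V) -> \bar R) (nu : set (borel V) -> \bar R) :=
  forall f : V -> R, continuous f -> (exists M, forall v, `|f v| <= M) ->
    (fun t => \int[mu t]_v (f v)%:E)%E @ +oo --> (\int[nu]_v (f v)%:E)%E.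

Section kernels.
Context {R : realType}.
Local Notation leb := (@lebesgue_measure R).

Definition dkernel (K : R -> R -> R) (u r : R) : R := derive1 (K ^~ r) u.

Definition volterra_kernel (alpha : R) (K : R -> R -> R) :=
  [/\ measurable_fun setT (fun z : R * R => K z.1 z.2),
      forall t r, t < r -> K t r = 0,
      forall r, K t r @[t --> r^'+] --> (0 : R),
      forall r u, r < u ->
        derivable (K ^~ r) u 1 /\ {for u, continuous (dkernel K ^~ r)}
    & exists2 C, 0 < C & forall r u, r < u ->
        `|dkernel K u r| <= C * (u - r) `^ (alpha - 1)].

Definition volterra_cov (K : R -> R -> R) (s1 t1 s2 t2 : R) : R :=
  \int[leb]_r ((K t1 r - K s1 r) * (K t2 r - K s2 r)).

End kernels.

Section step_functions.
Context {R : realType} {V : hilbertType R}.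
Local Notation leb := (@lebesgue_measure R).

(* [sf_coef j] is the value on [[sf_node j, sf_node j.+1)], [j < sf_size]. *)
Record stepfun := StepFun {
  sf_size : nat;
  sf_node : nat -> R;
  sf_coef : nat -> V;
  sf_node_lt : forall j, (j < sf_size)%N -> sf_node j < sf_node j.+1 }.

Definition sf_cell (f : stepfun) (j : nat) : set R :=
  `[sf_node f j, sf_node f j.+1[%classic.

Definition sf_eval (f : stepfun) (u : R) : V :=
  \sum_(j < sf_size f) (\1_(sf_cell f j) u : R) *: sf_coef f j.

(* [int_r^oo f(u) dK/du(u, r) du]: since [f] takes values in the span of its
   coefficients, the vector-valued integral is this combination of scalar
   ones. *)
Definition Kstar (K : R -> R -> R) (f : stepfun) (r : R) : V :=
  \sum_(j < sf_size f)
    (\int[leb]_(u in `]r, +oo[) ((\1_(sf_cell f j) u : R) * dkernel K u r))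
      *: sf_coef f j.

Definition stepdist (K : R -> R -> R) (f g : stepfun) : \bar R :=
  bLnorm leb 2 (fun r => Kstar K f r - Kstar K g r).

Lemma stepdistxx K f : stepdist K f f = 0%E.
Proof.
rewrite /stepdist /bLnorm.
under eq_Lnorm do rewrite subrr normr0.
exact: Lnorm0.
Qed.

(* Completion of the step functions, an element being represented by a Cauchy
   sequence; representatives at distance [Ddist] zero stand for the same
   element. This also takes the quotient by the kernel of [Kstar]. *)
Record Dspace (K : R -> R -> R) := DSpace {
  Dseq :> nat -> stepfun;
  Dseq_cauchy : forall eps : R, 0 < eps -> exists N, forall m n,
    (N <= m)%N -> (N <= n)%N -> (stepdist K (Dseq m) (Dseq n) < eps%:E)%E }.

Definition Ddist K (phi psi : Dspace K) : \bar R :=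
  limn (fun n => stepdist K (phi n) (psi n)).

Definition sf0 : stepfun :=
  @StepFun 0 (fun=> 0) (fun=> 0) (fun j (H : (j < 0)%N) => False_ind _ (notF H)).

Lemma D0_cauchy K (eps : R) : 0 < eps -> exists N, forall m n,
  (N <= m)%N -> (N <= n)%N -> (stepdist K sf0 sf0 < eps%:E)%E.
Proof. by move=> e0; exists 0%N => m n _ _; rewrite stepdistxx lte_fin. Qed.

Definition D0 K : Dspace K := @DSpace K (fun=> sf0) (@D0_cauchy K).

(* [phi] is the image of [f] in [L^{2/(1+2 alpha)}(R;V)] under the continuous
   extension of the inclusion of step functions into D(R;V). *)
Definition represents (alpha : R) K (f : R -> V) (phi : Dspace K) :=
  let p := 2 / (1 + 2 * alpha) in
  bLfun leb p f /\
  bLnorm leb p (fun u => sf_eval (phi n) u - f u) @[n --> \oo] --> 0%E.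

End step_functions.
Arguments stepfun {R} V.
Arguments Dspace {R} V K.

Section processes.
Context {R : realType} {d : measure_display} {Omega : measurableType d}.
Variable P : probability Omega R.

Section scalar_integral.
Context {V : hilbertType R}.

Definition step_integral (b : R -> Omega -> R) (f : stepfun V) (w : Omega) : V :=
  \sum_(j < sf_size f)
    (b (sf_node f j.+1) w - b (sf_node f j) w) *: sf_coef f j.

(* [Y] is a version of the extension to D(R;V) of [step_integral b]. *)
Definition D_integral (b : R -> Omega -> R) K (phi : Dspace V K)
    (Y : Omega -> V) :=
  bLfun P 2 Y /\
  bLnorm P 2 (fun w => step_integral b (phi n) w - Y w) @[n --> \oo] --> 0%E.

End scalar_integral.

Section cylindrical.
Context {U : hilbertType R}.

(* [B t u] is a representative of a class in [L^2(Omega)]; hence [B t] is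
   linear up to null sets only. *)
Definition cyl_volterra (alpha : R) (K : R -> R -> R)
    (B : R -> U -> Omega -> R) :=
  volterra_kernel alpha K /\
  [/\ forall t u, B t u \in Lfun P 2%:E,
      forall t a u v,
        {ae P, forall w, B t (a *: u + v) w = a * B t u w + B t v w},
      forall t, exists M : R, forall u,
        ('N[P]_2%:E[EFin \o B t u] <= (M * `|u|)%:E)%E,
      forall u, {ae P, forall w, B 0 u w = 0}
    & (forall t u, 'E_P[B t u] = 0)%E /\
      forall s1 t1 s2 t2 u1 u2,
        'E_P[(fun w => (B t1 u1 w - B s1 u1 w) * (B t2 u2 w - B s2 u2 w))%R]%E
        = (volterra_cov K s1 t1 s2 t2 * inner u1 u2)%:E].

Context {V : hilbertType R}.

(* [(N, g)] encodes the elementary operator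
   [u |-> \sum_(k < N) <u, e_k> g_k], which maps [e_k] to [elem_coef k]. *)
Definition elem_coef K (N : nat) (g : nat -> Dspace V K) (k : nat) :=
  if (k < N)%N then g k else D0 K.

Definition elem_integral (e : onbasis U) (B : R -> U -> Omega -> R) K (N : nat)
    (g : nat -> Dspace V K) (Y : Omega -> V) :=
  exists2 Z : nat -> Omega -> V,
    (forall k, (k < N)%N -> onb_dom e k ->
      D_integral (fun t => B t (e k)) (g k) (Z k))
    & Y = fun w => \sum_(k < N | onb_dom e k) Z k w.

(* Squared distance in [L_2(U, D(R;V))]. *)
Definition hs_sqdist (e : onbasis U) K (G H : nat -> Dspace V K) : \bar R :=
  (\sum_(k <oo | onb_dom e k) Ddist (G k) (H k) ^+ 2)%E.

(* [Y] is a version of [I(T)], [T] in [L_2(U, D(R;V))]. *)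
Definition cyl_integral (e : onbasis U) (B : R -> U -> Omega -> R) K
    (T : U -> Dspace V K) (Y : Omega -> V) :=
  bLfun P 2 Y /\
  exists (N : nat -> nat) (g : nat -> nat -> Dspace V K)
         (Z : nat -> Omega -> V),
    [/\ forall m, elem_integral e B (N m) (g m) (Z m),
        hs_sqdist e (elem_coef (N m) (g m)) (fun k => T (e k)) @[m --> \oo]
          --> 0%E
      & bLnorm P 2 (fun w => Z m w - Y w) @[m --> \oo] --> 0%E].

Definition is_stoch_integral (alpha : R) (e : onbasis U)
    (B : R -> U -> Omega -> R) (K : R -> R -> R) (s t : R) (G : R -> U -> V)
    (Y : Omega -> V) :=
  exists2 T : U -> Dspace V K,
    (forall u,
      represents alpha (fun r => (\1_(`[s, t[%classic) r : R) *: G r u) (T u))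
    & cyl_integral e B T Y.

(* A version of [int_s^t G dB], with junk value 0 when it is undefined. *)
Definition stoch_integral alpha e B K s t G : Omega -> V :=
  xget (fun=> 0) [set Y | is_stoch_integral alpha e B K s t G Y].

Definition law (X : Omega -> V) : set (borel V) -> \bar R :=
  pushforward P (X : Omega -> borel V).

Definition mild_solution alpha e B K (S : R -> {linear V -> V})
    (Phi : {linear U -> V}) (x : Omega -> V) (t : R) (w : Omega) : V :=
  S t (x w) + stoch_integral alpha e B K 0 t (fun r u => S (t - r) (Phi u)) w.

End cylindrical.

Definition same_law d' (E : measurableType d') (X Y : Omega -> E) :=
  forall A : set E, measurable A -> pushforward P X A = pushforward P Y A.

Definition increment m (Y : R -> Omega -> m.-tuple R) (s t : R) (w : Omega) :
    m.-tuple R :=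
  [tuple tnth (Y t w) k - tnth (Y s w) k | k < m].

Definition increments m n (Y : R -> Omega -> m.-tuple R) (s t : 'I_n -> R)
    (w : Omega) : n.-tuple (m.-tuple R) :=
  [tuple increment Y (s i) (t i) w | i < n].

Definition stationary_increments m (Y : R -> Omega -> m.-tuple R) :=
  forall n (s t : 'I_n -> R) (h : R), (forall i, s i < t i) ->
    same_law (increments Y s t)
             (increments Y (fun i => s i + h) (fun i => t i + h)).

Definition reflexive_increments m (Y : R -> Omega -> m.-tuple R) :=
  forall n (s t : 'I_n -> R), (forall i, s i < t i) ->
    same_law (increments Y s t)
             (increments Y (fun i => - t i) (fun i => - s i)).

Definition cyl_tuple (U : hilbertType R) (B : R -> U -> Omega -> R) m
    (u : 'I_m -> U) (t : R) (w : Omega) : m.-tuple R :=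
  [tuple B t (u k) w | k < m].

Definition cyl_stationary (U : hilbertType R) (B : R -> U -> Omega -> R) :=
  forall m (u : 'I_m -> U), stationary_increments (cyl_tuple B u).

Definition cyl_reflexive (U : hilbertType R) (B : R -> U -> Omega -> R) :=
  forall m (u : 'I_m -> U), reflexive_increments (cyl_tuple B u).

End processes.

(* Main.v *)
(** The stochastic convolution [Z t] does not depend on the initial condition,
so [X^x_t = Z t + S t x] while [X^0_t = Z t], and the claim is Slutsky's theorem:
[Z t -> mu_inf] in law and [S t x -> 0] almost surely imply that
[Z t + S t x -> mu_inf] in law. Test functions being merely continuous and
bounded, a test function [f] is bounded from below by its [k]-Lipschitz
envelopes [inf_y (f y + k |y - v|)], which increase to [f] pointwise; the shift
[S t x] is negligible in a Lipschitz function, so [liminf E f(Z t + S t x)] is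
at least [int f d mu_inf], and the converse bound is the same for [- f]. *)
Require Import Defs.
From HB Require Import structures.
From mathcomp Require Import all_boot all_order all_algebra.
From mathcomp Require Import all_classical all_reals all_analysis measurable_realfun lra.
Set Implicit Arguments.
Unset Strict Implicit.
Unset Printing Implicit Defensive.
Import Order.TTheory GRing.Theory Num.Theory.
Import numFieldNormedType.Exports.

Local Open Scope classical_set_scope.
Local Open Scope ring_scope.

(** * Borel measurability of maps into a separable Hilbert space *)

Lemma separable_seq_dense (R : realType) (V : hilbertType R) :
  separable V -> exists a : nat -> V,
    forall v (eps : R), 0 < eps -> exists n, `|v - a n| < eps.
Proof.
move=> [D /countable_injP[c cinj] dD].
(* The sequence inverts the injection [c] of [D] into the naturals. Indices outside the image of [D]
   get the junk value 0, which is harmless since only indices [c u] with [u] in [D] are ever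
   used. *)
exists (fun n => xget 0 [set v | D v /\ c v = n]) => v eps eps0.
have [u [vu Du]] : ball v eps `&` D !=set0.
  by apply: dD; [exists v; exact: ballxx|exact: ball_open].
exists (c u); rewrite (@xget_unique _ _ _ u) //.
  by rewrite -ball_normE in vu.
by move=> y [Dy cy]; apply: cinj => //; rewrite inE.
Qed.

Lemma borel_measurable_comp_continuous d (T : measurableType d) (R : realType)
    (V W : hilbertType R) (f : V -> W) (X : T -> V) :
  continuous f -> measurable_fun setT (X : T -> borel V) ->
  measurable_fun setT (f \o X : T -> borel W).
Proof.
move=> /continuousP cf mX; apply: (@measurability _ _ _ (borel W) _ _ (@open W) erefl).
move=> _ [A oA <-]; rewrite comp_preimage; apply: mX => //.
by apply: sub_sigma_algebra; exact: cf.
Qed.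

Lemma borel_measurable_continuous (R : realType) (V : hilbertType R)
    (f : V -> R) : continuous f -> measurable_fun setT (f : borel V -> R).
Proof.
move=> /continuousP cf; apply: (measurability _ (RGenOpens.measurableE R)).
move=> _ [_ [a [b ->] <-]]; rewrite setTI.
by apply: sub_sigma_algebra; apply: cf; exact: interval_open.
Qed.

Lemma measurable_continuous_comp d (T : measurableType d) (R : realType)
    (V : hilbertType R) (f : V -> R) (X : T -> V) : continuous f ->
  measurable_fun setT (X : T -> borel V) -> measurable_fun setT (f \o X).
Proof.
by move=> cf; exact: measurableT_comp (borel_measurable_continuous cf).
Qed.

(** Addition is continuous, and separability makes the preimage of an open set a countable union of
    events in which [X] and [Y] lie in balls centred on a dense sequence, with radii [1/(i+1)]. *)
Lemma borel_measurableD d (T : measurableType d) (R : realType)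
    (V : hilbertType R) (X Y : T -> V) : separable V ->
  measurable_fun setT (X : T -> borel V) ->
  measurable_fun setT (Y : T -> borel V) ->
  measurable_fun setT (X \+ Y : T -> borel V).
Proof.
move=> /separable_seq_dense[a da] mX mY.
apply: (@measurability _ _ _ (borel V) _ _ (@open V) erefl) => _ [A oA <-]; rewrite setTI.
pose r i : R := i.+1%:R^-1.
pose F m n i := [set w | [/\ ball (a m) (r i) (X w), ball (a n) (r i) (Y w) &
  forall u v, ball (a m) (r i) u -> ball (a n) (r i) v -> A (u + v)]].
suff -> : (X \+ Y) @^-1` A = \bigcup_m \bigcup_n \bigcup_i F m n i.
  apply: bigcupT_measurable => m; apply: bigcupT_measurable => n.
  apply: bigcupT_measurable => i.
  (* [Q] does not involve [w], so [F m n i] is either empty or the intersection of two preimages of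
     balls. *)
  rewrite /F; set Q := (forall u v, _).
  have [q|nq] := pselect Q; last first.
    by rewrite (_ : mkset _ = set0)//; apply/seteqP; split => // w [].
  rewrite (_ : mkset _ = X @^-1` ball (a m) (r i) `&`
                       Y @^-1` ball (a n) (r i)).
    apply: measurableI; rewrite -[X in measurable X]setTI.
      by apply: mX => //; apply: sub_sigma_algebra; exact: ball_open.
    by apply: mY => //; apply: sub_sigma_algebra; exact: ball_open.
  by apply/seteqP; split => w /= [].
apply/seteqP; split => w /=; last first.
  by move=> [m _ [n _ [i _ [Xw Yw]]]]; exact.
move=> Aw; have /nbhs_ballP[eps /= eps0 epsA] := open_nbhs_nbhs (conj oA Aw).
(* A quarter of [eps], because the triangle inequality below splits the distance into four pieces,
   each shorter than [r i]. *)
have [i ri] : exists i, r i < eps / 4.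
  near \oo => i; exists i; rewrite /r; near: i.
  by apply: near_infty_natSinv_lt (PosNum (divr_gt0 eps0 _)).
have ri0 : 0 < r i by rewrite invr_gt0.
have [m Xm] := da (X w) _ ri0; have [n Yn] := da (Y w) _ ri0.
exists m => //; exists n => //; exists i => //.
rewrite /F/= -!ball_normE/=; split; [by rewrite distrC|by rewrite distrC|].
move=> u v um vn; apply: epsA; rewrite -ball_normE/=.
rewrite (_ : _ - _ = (X w - a m) + (a m - u) + ((Y w - a n) + (a n - v))); last first.
  by rewrite !subrKA opprD addrACA.
have := ler_normD (X w - a m + (a m - u)) (Y w - a n + (a n - v)).
have := ler_normD (X w - a m) (a m - u); have := ler_normD (Y w - a n) (a n - v).
lra.
Unshelve. all: by end_near. Qed.

(** * Integrals of bounded functions under a probability *)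

Section bounded_Rintegral.
Context {R : realType} {d : measure_display} {T : measurableType d}.
Variables (mu : probability T R) (M : R).

Lemma bounded_integrable (h : T -> R) : measurable_fun setT h ->
  (forall x, `|h x| <= M) -> mu.-integrable setT (EFin \o h).
Proof.
move=> mh hM; apply: measurable_bounded_integrable => //.
  by rewrite (le_lt_trans (probability_le1 mu measurableT))// ltry.
by exists M; split; [exact: num_real|move=> x /ltW Mx y _; exact: le_trans Mx].
Qed.

(** Dominated convergence: the constant [M] is integrable because [mu] is finite. *)
Lemma bounded_cvg_Rintegral (h_ : nat -> T -> R) (h : T -> R) :
  (forall n, measurable_fun setT (h_ n)) -> measurable_fun setT h ->
  (forall n x, `|h_ n x| <= M) ->
  {ae mu, forall x, h_ n x @[n --> \oo] --> h x} ->
  \int[mu]_x h_ n x @[n --> \oo] --> \int[mu]_x h x.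
Proof.
move=> mh_ mh h_M h_h.
have mE n : measurable_fun setT (EFin \o h_ n) by exact/measurable_EFinP.
have mhE : measurable_fun setT (EFin \o h) by exact/measurable_EFinP.
have h_hE : {ae mu, forall x, setT x -> (h_ n x)%:E @[n --> \oo] --> (h x)%:E}.
  by apply: filterS h_h => x h_hx _; apply/fine_cvgP; split=> //; exact: nearW.
have iM : mu.-integrable setT (EFin \o cst M).
  exact: finite_measure_integrable_cst.
have [|ih _ +] := dominated_convergence measurableT mE mhE h_hE iM.
  by apply: aeW => x n _ /=; rewrite lee_fin.
by rewrite -(fineK (integrable_fin_num _ ih))//; exact: fine_cvg.
Qed.

End bounded_Rintegral.

(** * Lipschitz envelopes of a bounded function *)

Section lipschitz_envelope.
Context {R : realType} {V : hilbertType R}.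
Variables (f : V -> R) (M : R).
Hypothesis fM : forall v, `|f v| <= M.

(** The infimal convolution of [f] with [k] times the norm: for [k >= 0], the largest [k]-Lipschitz
    minorant of [f]. The lower bound [- M] of [f] then makes it a genuine infimum rather than a
    default value of [inf]. *)
Definition lip_env (k : R) (v : V) : R :=
  inf (range (fun y => f y + k * `|y - v|)).

Let has_inf_lip_env k v : 0 <= k -> has_inf (range (fun y => f y + k * `|y - v|)).
Proof.
move=> k0; split; first by exists (f v + k * `|v - v|), v.
exists (- M) => _ [y _ <-]; rewrite -[leLHS]addr0 lerD ?mulr_ge0//.
by have := fM y; rewrite ler_norml => /andP[].
Qed.

Lemma lip_env_le k v y : 0 <= k -> lip_env k v <= f y + k * `|y - v|.
Proof.
by move=> k0; apply: ge_inf; [exact: (has_inf_lip_env _ k0).2|exists y].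
Qed.

Lemma le_lip_env k v c : 0 <= k -> (forall y, c <= f y + k * `|y - v|) ->
  c <= lip_env k v.
Proof.
move=> k0 cf; apply: lb_le_inf => [|_ [y _ <-]//].
exact: (has_inf_lip_env _ k0).1.
Qed.

Lemma lip_env_le_id k v : 0 <= k -> lip_env k v <= f v.
Proof. by move=> /lip_env_le-/(_ v v); rewrite subrr normr0 mulr0 addr0. Qed.

Lemma normr_lip_env k v : 0 <= k -> `|lip_env k v| <= M.
Proof.
move=> k0; rewrite ler_norml; apply/andP; split.
  apply: le_lip_env => // y; rewrite -[leLHS]addr0 lerD ?mulr_ge0//.
  by have := fM y; rewrite ler_norml => /andP[].
by rewrite (le_trans (lip_env_le_id _ k0))// (le_trans (ler_norm _)).
Qed.

(** An infimum of [k]-Lipschitz functions of the base point is [k]-Lipschitz; by symmetry one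
    inequality is enough. *)
Lemma lip_env_lipschitz k u v : 0 <= k ->
  `|lip_env k u - lip_env k v| <= k * `|u - v|.
Proof.
move=> k0; wlog suff: u v / lip_env k u <= lip_env k v + k * `|u - v|.
  move=> lip; have := lip u v; have := lip v u; rewrite (distrC v u) ler_norml.
  lra.
rewrite -lerBlDr; apply: le_lip_env => // y; rewrite lerBlDr.
rewrite (le_trans (lip_env_le _ y k0))// -addrA lerD2l -mulrDr ler_wpM2l//.
by rewrite (le_trans (ler_distD v _ _))// (distrC v).
Qed.

Lemma continuous_lip_env k : 0 <= k -> continuous (lip_env k).
Proof.
move=> k0 v; apply/cvgrPdist_lt => eps eps0.
(* [k + 1] is positive even when [k = 0], so [eps / (k + 1)] can serve as radius. *)
have k1 : 0 < k + 1 by rewrite ltr_wpDl.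
near=> u; rewrite (le_lt_trans (lip_env_lipschitz _ _ k0))//.
rewrite (@le_lt_trans _ _ ((k + 1) * `|v - u|))//.
  by rewrite ler_wpM2r// lerDl.
rewrite -ltr_pdivlMl// mulrC; near: u.
by apply: cvgr_dist_lt; [exact: cvg_id|rewrite divr_gt0].
Unshelve. all: by end_near. Qed.

(** For [y] close to [v], continuity at [v] keeps [f y] above [f v - eps]. At distance at least [r],
    the penalty [n * r] eventually exceeds [2 M], the largest possible gap between values of [f]. *)
Lemma cvg_lip_env v : {for v, continuous f} ->
  lip_env n%:R v @[n --> \oo] --> f v.
Proof.
move=> /cvgrPdist_le cf; apply/cvgrPdist_le => eps eps0.
have /nbhs_ballP[r /= r0 rf] := cf _ eps0.
near=> n; rewrite ger0_norm ?subr_ge0 ?lip_env_le_id//.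
rewrite lerBlDr -lerBlDl; apply: le_lip_env => // y.
have [yv|vy] := ltP `|y - v| r.
  have := rf y; rewrite -ball_normE/= distrC => /(_ yv).
  have : 0 <= n%:R * `|y - v| by rewrite mulr_ge0.
  rewrite ler_norml; lra.
have : M *+ 2 <= n%:R * `|y - v|.
  rewrite (@le_trans _ _ (n%:R * r))// ?ler_wpM2l//.
  rewrite -ler_pdivrMr//; near: n; exact: nbhs_infty_ger.
have := fM v; have := fM y; rewrite !ler_norml; lra.
Unshelve. all: by end_near. Qed.

End lipschitz_envelope.

(** * Slutsky's theorem, first along sequences, then in continuous time *)

Section slutsky.
Context {R : realType} {d : measure_display} {Omega : measurableType d}.
Context {V : hilbertType R}.
Variables (P : probability Omega R) (nu : probability (borel V) R).
Hypothesis sepV : separable V.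

Lemma integral_law (X : Omega -> V) (f : V -> R) (M : R) :
  measurable_fun setT (X : Omega -> borel V) ->
  continuous f -> (forall v, `|f v| <= M) ->
  (\int[law P X]_v (f v)%:E)%E = (\int[P]_w f (X w))%:E.
Proof.
move=> mX cf fM; have mf := borel_measurable_continuous cf.
have ifX : P.-integrable setT (EFin \o (f \o X)).
  have mfX := measurable_continuous_comp cf mX.
  exact: (bounded_integrable P mfX (fun w => fM (X w))).
rewrite integral_pushforward//; last exact/measurable_EFinP.
by rewrite fineK//; exact: integrable_fin_num ifX.
Qed.

Section sequences.
Variables X Y : nat -> Omega -> V.
Hypothesis mX : forall n, measurable_fun setT (X n : Omega -> borel V).
Hypothesis mY : forall n, measurable_fun setT (Y n : Omega -> borel V).
Hypothesis Y0 : {ae P, forall w, `|Y n w| @[n --> \oo] --> (0 : R)}.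
Hypothesis Xnu : forall f : V -> R, continuous f ->
  (exists M, forall v, `|f v| <= M) ->
  \int[P]_w f (X n w) @[n --> \oo] --> \int[nu]_v f v.

(** One third of [eps] each pays for passing from [f] to an envelope under [nu], for the weak
    convergence of [X n] tested on that envelope, and for the shift [Y n]. Returning from the
    envelope to [f] costs nothing, since [g k <= f]. *)
Let slutsky_gt (f : V -> R) (M eps : R) : continuous f ->
  (forall v, `|f v| <= M) -> 0 < eps ->
  \forall n \near \oo, \int[nu]_v f v - eps < \int[P]_w f (X n w + Y n w).
Proof.
move=> cf fM eps0.
pose g k : V -> R := lip_env f k%:R.
have cg k : continuous (g k) by exact: continuous_lip_env.
have gM k v : `|g k v| <= M by exact: normr_lip_env.
have mXY n : measurable_fun setT (X n \+ Y n : Omega -> borel V).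
  exact: borel_measurableD.
have e3 : 0 < eps / 3 by rewrite divr_gt0.
(* [k] is fixed before [n], so that a single Lipschitz constant controls the shift for all [n]. *)
have [k gk] : exists k, \int[nu]_v f v - eps / 3 < \int[nu]_v g k v.
  have : \int[nu]_v g k v @[k --> \oo] --> \int[nu]_v f v.
    apply: (bounded_cvg_Rintegral (M := M)) => //.
    - by move=> k; exact: borel_measurable_continuous.
    - exact: borel_measurable_continuous.
    - by apply: aeW => v; exact: cvg_lip_env (cf v).
  move=> /cvgrPdist_lt/(_ _ e3) gf; near \oo => k; exists k.
  have : `|\int[nu]_v f v - \int[nu]_v g k v| < eps / 3 by near: k.
  by rewrite ltr_norml; lra.
have ig n Z : measurable_fun setT (Z : Omega -> borel V) ->
    P.-integrable setT (EFin \o (g n \o Z)).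
  move=> /(measurable_continuous_comp (cg n)) mgZ.
  exact: (bounded_integrable P mgZ (fun w => gM n (Z w))).
have mgXY n := measurable_continuous_comp (cg k) (mXY n).
have mgX n := measurable_continuous_comp (cg k) (mX n).
have mfXY n := measurable_continuous_comp cf (mXY n).
(* The integrand is at most [k * |Y n|], which tends to 0 almost surely, and is bounded by [M + M];
   bounded convergence applies. *)
have gXY : \int[P]_w (g k (X n w + Y n w) - g k (X n w)) @[n --> \oo] --> (0 : R).
  rewrite [X in _ --> X](_ : _ = \int[P]_w (cst 0 w)); last first.
    by rewrite Rintegral_cst// mul0r.
  apply: (bounded_cvg_Rintegral (M := M + M)).
  - by move=> n; exact: measurable_funB (mgXY n) (mgX n).
  - exact: measurable_cst.
  - by move=> n w; rewrite (le_trans (ler_normB _ _))// lerD.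
  - apply: filterS Y0 => w Yw; apply/norm_cvg0P.
    apply: (@squeeze_cvgr _ _ _ _ (cst 0) (fun n => k%:R * `|Y n w|)).
    + near=> n; rewrite normr_ge0/= (le_trans (lip_env_lipschitz fM _ _ _))//.
      by rewrite addrAC subrr add0r.
    + exact: cvg_cst.
    + by rewrite -[X in _ --> X](mulr0 k%:R); apply: cvgM => //; exact: cvg_cst.
have gX : \int[P]_w g k (X n w) @[n --> \oo] --> \int[nu]_v g k v.
  by apply: Xnu => //; exists M.
move/cvgrPdist_lt : gX => /(_ _ e3) gX.
move/cvgrPdist_lt : gXY => /(_ _ e3) gXY.
near=> n.
have gf : \int[P]_w g k (X n w + Y n w) <= \int[P]_w f (X n w + Y n w).
  apply: le_Rintegral => //; first exact: (ig _ (X n \+ Y n)).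
    exact: (bounded_integrable P (mfXY n) (fun w => fM (X n w + Y n w))).
  by move=> w _; exact: (lip_env_le_id fM).
have : `|\int[nu]_v g k v - \int[P]_w g k (X n w)| < eps / 3 by near: n.
have : `|0 - \int[P]_w (g k (X n w + Y n w) - g k (X n w))| < eps / 3 by near: n.
rewrite RintegralB//; [|exact: (ig _ (X n \+ Y n))|exact: (ig _ (X n))].
rewrite !ltr_norml; lra.
Unshelve. all: by end_near. Qed.

Lemma slutsky_cvg (f : V -> R) (M : R) : continuous f ->
  (forall v, `|f v| <= M) ->
  \int[P]_w f (X n w + Y n w) @[n --> \oo] --> \int[nu]_v f v.
Proof.
move=> cf fM; apply/cvgrPdist_lt => eps eps0.
have cNf : continuous (fun v => - f v) by move=> v; apply: cvgN; exact: cf.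
have NfM v : `|- f v| <= M by rewrite normrN.
have lo := slutsky_gt cf fM eps0.
have hi := slutsky_gt cNf NfM eps0.
have RintegralN d' (T : measurableType d') (p : probability T R) (h : T -> R) :
    measurable_fun setT h -> (forall x, `|h x| <= M) ->
    \int[p]_x (- h x) = - \int[p]_x h x.
  move=> mh hM; rewrite -mulN1r -RintegralZl//.
    by apply: eq_Rintegral => x _; rewrite mulN1r.
  exact: bounded_integrable hM.
have mf := borel_measurable_continuous cf.
have mfXY n :=
  measurable_continuous_comp cf (borel_measurableD sepV (mX n) (mY n)).
near=> n; have : \int[nu]_v f v - eps < \int[P]_w f (X n w + Y n w) by near: n.
have : \int[nu]_v (- f v) - eps < \int[P]_w (- f (X n w + Y n w)) by near: n.
rewrite RintegralN// (RintegralN _ _ _ _ (mfXY n) (fun w => fM _)).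
rewrite ltr_norml /=; lra.
Unshelve. all: by end_near. Qed.

End sequences.

(** A limit at [+oo] can be tested along the sequences tending to [+oo], which reduces the claim to
    [slutsky_cvg]. Measurability is asked for [t >= 0] only, as a semigroup is constrained only
    there. *)
Lemma weak_cvg_lawD (X Y : R -> Omega -> V) :
  (forall t, 0 <= t -> measurable_fun setT (X t : Omega -> borel V)) ->
  (forall t, 0 <= t -> measurable_fun setT (Y t : Omega -> borel V)) ->
  {ae P, forall w, `|Y t w| @[t --> +oo] --> (0 : R)} ->
  weak_cvg (fun t => law P (X t)) nu ->
  weak_cvg (fun t => law P (fun w => X t w + Y t w)) nu.
Proof.
move=> mX mY Y0 Xnu f cf [M fM].
have nuE (h : V -> R) : continuous h -> (exists M, forall v, `|h v| <= M) ->
    (\int[nu]_v (h v)%:E)%E = (\int[nu]_v h v)%:E.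
  move=> ch [N hN]; rewrite fineK//; apply: integrable_fin_num => //.
  exact: (bounded_integrable nu (borel_measurable_continuous ch) hN).
have mXY t : 0 <= t ->
    measurable_fun setT ((fun w => X t w + Y t w) : Omega -> borel V).
  by move=> t0; apply: borel_measurableD => //; [exact: mX|exact: mY].
have lawE (Z : R -> Omega -> V) (h : V -> R) :
    (forall t, 0 <= t -> measurable_fun setT (Z t : Omega -> borel V)) ->
    continuous h -> (exists M, forall v, `|h v| <= M) -> \forall t \near +oo,
    (\int[law P (Z t)]_v (h v)%:E)%E = (\int[P]_w h (Z t w))%:E.
  move=> mZ ch [N hN]; near=> t; apply: integral_law hN => //; apply: mZ.
  by near: t; exact: nbhs_pinfty_ge.
have bf : exists M, forall v, `|f v| <= M by exists M.
rewrite nuE//.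
suff fXY : \int[P]_w f (X t w + Y t w) @[t --> +oo] --> \int[nu]_v f v.
  have : (\int[P]_w f (X t w + Y t w))%:E @[t --> +oo] --> (\int[nu]_v f v)%:E.
    by apply: cvg_EFin => //; exact: nearW.
  apply: cvg_trans; apply: near_eq_cvg.
  have := lawE (fun t w => X t w + Y t w) f mXY cf bf.
  by apply: filterS => t ->.
apply/cvg_pinftyP => u uoo.
(* The sequence [u] may start with negative times, where measurability is unknown. Truncating at 0
   gives it for every [n] and leaves all but finitely many terms unchanged. *)
pose v n := Num.max (u n) 0.
have v0 n : 0 <= v n by rewrite le_max lexx orbT.
have vu : \forall n \near \oo, v n = u n.
  near=> n; apply/max_idPl; near: n.
  by move/cvgryPge : uoo; exact.
have voo : v n @[n --> \oo] --> +oo.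
  by apply: cvg_trans uoo; apply: near_eq_cvg; exact: filterS vu.
suff : \int[P]_w f (X (v n) w + Y (v n) w) @[n --> \oo] --> \int[nu]_v f v.
  apply: cvg_trans; apply: near_eq_cvg; apply: filterS vu => n ->//.
apply: (slutsky_cvg _ _ _ _ cf fM).
- by move=> n; exact: mX.
- by move=> n; exact: mY.
- apply: filterS Y0 => w /cvg_pinftyP; exact.
move=> h ch bh.
have := Xnu h ch bh; rewrite nuE// => /fine_cvgP[_ hX].
have : \int[P]_w h (X t w) @[t --> +oo] --> \int[nu]_v h v.
  apply: cvg_trans hX; apply: near_eq_cvg.
  by apply: filterS (lawE _ _ mX ch bh) => t /= ->.
by move=> /cvg_pinftyP; exact.
Unshelve. all: by end_near. Qed.

End slutsky.

(** * Application to the mild solution *)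

Lemma measurable_stoch_integral (R : realType) (d : measure_display)
    (Omega : measurableType d) (P : probability Omega R) (U V : hilbertType R)
    alpha (e : onbasis U) (B : R -> U -> Omega -> R) K (s t : R)
    (G : R -> U -> V) :
  measurable_fun setT (stoch_integral P alpha e B K s t G : Omega -> borel V).
Proof.
(* Either [xget] picks a version of the integral, measurable by the [bLfun] clause of
   [cyl_integral], or it returns the constant default 0. *)
rewrite /stoch_integral; case: xgetP => [Y _ [T _ [[mY _] _]]|_] //.
Qed.

Theorem proposition3p5 (R : realType) (d : measure_display)
    (Omega : measurableType d) (P : probability Omega R)
    (U V : hilbertType R) (e : onbasis U) (alpha : R) (K : R -> R -> R)
    (B : R -> U -> Omega -> R) (S : R -> {linear V -> V})
    (DA : set V) (A : V -> V) (Phi : {linear U -> V})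
    (mu_inf : probability (borel V) R) :
  separable U -> separable V ->
  0 < alpha < 2^-1 ->
  cyl_volterra P alpha K B ->
  c0_semigroup S -> is_generator S DA A ->
  continuous Phi ->
  cyl_stationary P B -> cyl_reflexive P B ->
  (forall u, 0 < u -> hilbert_schmidt e (S u \o Phi)) ->
  (\int[lebesgue_measure]_(r in `]0%R, +oo[)
     hs_norm e (S r \o Phi) `^ (2 / (1 + 2 * alpha)) < +oo)%E ->
  let mu (x : Omega -> V) (t : R) :=
    law P (mild_solution P alpha e B K S Phi x t) in
  weak_cvg (mu (fun=> 0)) mu_inf ->
  (forall x : Omega -> V, bLfun P 2 x ->
     {ae P, forall w, `|S t (x w)| @[t --> +oo] --> (0 : R)} ->
     weak_cvg (mu x) mu_inf) /\
  (strongly_stable S ->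
     forall x : Omega -> V, bLfun P 2 x -> weak_cvg (mu x) mu_inf).

Proof.
move=> _ sepV _ _ [cS _ _ _] _ _ _ _ _ _ mu mu0.
(* Strong stability gives [S t (x w) --> 0] for every [w], so the second claim is an instance of the
   first. *)
suff cvg_mu x : bLfun P 2 x ->
    {ae P, forall w, `|S t (x w)| @[t --> +oo] --> (0 : R)} ->
    weak_cvg (mu x) mu_inf.
  split=> [//|S0 x Lx]; apply: cvg_mu => //; apply: aeW => w.
  exact/norm_cvg0P/S0.
move=> [mx _] Sx0; pose G t r u : V := S (t - r) (Phi u).
pose Z t := stoch_integral P alpha e B K 0 t (G t).
(* Stated for every [y] because it serves twice: for [x], and for the zero initial condition, where
   [S t 0 = 0] leaves the law of [Z t] alone. *)
have muE y : mu y = fun t => law P (fun w => Z t w + S t (y w)).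
  by apply/funext => t; congr law; apply/funext => w; rewrite addrC.
rewrite muE; apply: weak_cvg_lawD => //.
- by move=> t _; exact: measurable_stoch_integral.
- by move=> t t0; exact: (borel_measurable_comp_continuous (cS t t0) mx).
- move: mu0; rewrite muE.
  by under eq_fun do under [X in law _ X]eq_fun do rewrite linear0 addr0.
Qed.
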